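(* Let $K$ be a field complete with respect to a discrete valuation $v$ of residue characteristic $p$, normalized so that $v(p)=1$. Let $\ell\ge2$ with $p\mid\ell$ and $\ell\neq p$, $c\in\overline K$, $f(z)=z^\ell-c$ separable, $\alpha\in K$, and for $n\ge0$ let $K_n=K(\{\beta\in\overline K:f^n(\beta)=\alpha\})$, $K_\infty=\bigcup_{n\ge0}K_n$. If $v(c)\ge0$, then $K_\infty/K$ is infinitely wildly ramified.
   Context: $f^n$ is the $n$-fold composition of $f$. $K_\infty/K$ is infinitely wildly ramified if the $p$-parts of the ramification indices $e(K_n/K)$ are unbounded. *)

(* Defs.v *)
From HB Require Import structures.
From mathcomp Require Import all_boot all_order all_algebra.
From mathcomp Require Import separable.
From mathcomp Require Import finmap.
From mathcomp Require Import mathcomp_extra boolp classical_sets functions cardinality.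
From mathcomp Require Import constructive_ereal.

Set Implicit Arguments.
Unset Strict Implicit.
Unset Printing Implicit Defensive.

Import Order.TTheory GRing.Theory Num.Theory.

Local Open Scope classical_set_scope.
Local Open Scope ring_scope.

(* Rational values are enough: a discrete valuation v with v(p) = 1 takes its
   finite values in (1/e)Z on the field, hence in Q on an algebraic closure. *)
Record is_valuation (F : fieldType) (v : F -> \bar rat) : Prop := IsValuation {
  valuation_pinfty : forall x, v x = +oo%E <-> x = 0;
  valuation_ninfty : forall x, v x <> -oo%E;
  valuation_mul : forall x y, v (x * y) = (v x + v y)%E;
  valuation_add : forall x y, (Order.min (v x) (v y) <= v (x + y)%R)%E }.

(* The value group v(L^x) of a subset L of F that is a subfield. *)
Definition value_group (F : fieldType) (v : F -> \bar rat) (L : set F) :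
  set rat := [set q | exists2 x, L x & v x = q%:E].

Definition discrete_valuation (F : fieldType) (v : F -> \bar rat) : Prop :=
  is_valuation v /\
  exists2 g : rat, 0 < g & value_group v setT = range (fun n : int => g *~ n).

Definition valuation_cauchy (F : fieldType) (v : F -> \bar rat)
    (u : nat -> F) : Prop :=
  forall M : rat, exists N : nat, forall m n : nat,
    (N <= m)%N -> (N <= n)%N -> (M%:E <= v (u m - u n)%R)%E.

Definition valuation_cvg (F : fieldType) (v : F -> \bar rat)
    (u : nat -> F) (l : F) : Prop :=
  forall M : rat, exists N : nat, forall n : nat,
    (N <= n)%N -> (M%:E <= v (u n - l)%R)%E.

Definition valuation_complete (F : fieldType) (v : F -> \bar rat) : Prop :=
  forall u : nat -> F, valuation_cauchy v u -> exists l, valuation_cvg v u l.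

(* p \in [pchar k] for the residue field k = {v >= 0} / {v > 0}: the prime p
   vanishes in k, i.e. it lies in the maximal ideal {v > 0}. *)
Definition residue_char (F : fieldType) (v : F -> \bar rat) (p : nat) : Prop :=
  prime p /\ (0 < v p%:R%R)%E.

Definition is_algebraic_closure (K : fieldType) (Kbar : closedFieldType)
    (iota : {rmorphism K -> Kbar}) : Prop :=
  forall x : Kbar, algebraicOver iota x.

(* The subfield K(S) of Kbar. *)
Definition adjoin (K Kbar : fieldType) (iota : {rmorphism K -> Kbar})
    (S : set Kbar) : set Kbar :=
  smallest (fun L : set Kbar => GRing.divring_closed [in L])
    (range iota `|` S).

(* e(L/K) = [w(L^x) : w(K^x)], the number of cosets of the value group of K in
   that of L; it is 0 if the index is infinite, which does not happen for a
   finite extension L/K. *)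
Definition ramification_index (K Kbar : fieldType)
    (iota : {rmorphism K -> Kbar}) (w : Kbar -> \bar rat) (L : set Kbar) :
    nat :=
  #|` fset_set [set [set r | value_group w (range iota) (r - q)]
                | q in value_group w L] |.

(* The union of the tower Kn is infinitely wildly ramified over K: the p-parts
   of the ramification indices e(Kn/K) are unbounded. *)
Definition infinitely_wildly_ramified (K Kbar : fieldType)
    (iota : {rmorphism K -> Kbar}) (w : Kbar -> \bar rat) (p : nat)
    (Kn : nat -> set Kbar) : Prop :=
  forall B : nat, exists n : nat,
    (B < (ramification_index iota w (Kn n))`_p)%N.

Definition unicritical (F : fieldType) (l : nat) (c : F) : {poly F} :=
  'X^l - c%:P.

(* K_n = K(f^{-n}(alpha)). *)
Definition preimage_field (K Kbar : fieldType)
    (iota : {rmorphism K -> Kbar}) (f : {poly Kbar}) (alpha : K) (n : nat) :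
    set Kbar :=
  adjoin iota [set beta | iter n (horner f) beta = iota alpha].

(* Main.v *)
(* Write l = q m with q = p^r and p not dividing m. If y^l = y0 + c and x0 lies at
   distance 0 < v(y0 - x0) = d <= 1 from y0, then, as z^q is nearly additive modulo
   p, some preimage x of x0 satisfies v(y - x) = d / q, provided that m = 1 or y is a
   unit. Starting from one pair of points of the backward orbit of alpha at distance
   in (0, 1] -- two preimages of one point differing by a p-power root of unity --
   the values d / q^k all occur in the tower, and since the value group of K_n is
   (g/e)Z with e = e(K_n/K), where gZ is that of K, large powers of p divide e.
   For m >= 2 the orbit can be kept away from the residue class of -c, so that all
   later points are units. If no such orbit of units exists, then either some
   backward orbit has valuations s / l^k, with s <> 0, or all its points have
   valuation v(c) > 0; the latter forces m = 1, and v(c) is then so small that two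
   preimages of one point are at distance at most 1. This last case needs q > p. *)

Require Import Defs.
From HB Require Import structures.
From mathcomp Require Import all_boot all_order all_algebra.
From mathcomp Require Import separable.
From mathcomp Require Import finmap.
From mathcomp Require Import mathcomp_extra boolp classical_sets functions cardinality.
From mathcomp Require Import constructive_ereal.
From mathcomp Require Import ring lra zify.

Set Implicit Arguments.
Unset Strict Implicit.
Unset Printing Implicit Defensive.

Import Order.TTheory GRing.Theory Num.Theory.

Local Open Scope classical_set_scope.
Local Open Scope ring_scope.

(** * Ultrametric calculus for a valuation with rational values *)

Section Valuation.

Variables (F : fieldType) (w : F -> \bar rat).
Hypothesis w_val : is_valuation w.

Lemma val0 : w 0 = +oo%E.
Proof. exact/(valuation_pinfty w_val). Qed.

Lemma val_fin x : x != 0 -> exists q : rat, w x = q%:E.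
Proof.
move=> x0; case E : (w x) => [q||]; first by exists q.
  by move/(valuation_pinfty w_val) : E x0 => ->; rewrite eqxx.
by have := valuation_ninfty w_val E.
Qed.

Lemma val_neq0 x (q : rat) : w x = q%:E -> x != 0.
Proof. by move=> E; apply/eqP => x0; rewrite x0 val0 in E. Qed.

Lemma valM x y (a b : rat) : w x = a%:E -> w y = b%:E -> w (x * y) = (a + b)%:E.
Proof. by move=> Ex Ey; rewrite (valuation_mul w_val) Ex Ey. Qed.

Lemma val1 : w 1 = 0%:E.
Proof.
have [q E] := val_fin (oner_neq0 F).
have := valM E E; rewrite mulr1 E => -[] H.
by congr (_%:E); lra.
Qed.

Lemma valX x (a : rat) n : w x = a%:E -> w (x ^+ n) = (n%:R * a)%:E.
Proof.
move=> Ex; elim: n => [|n IH]; first by rewrite mul0r val1.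
by rewrite exprS (valM Ex IH); congr (_%:E); rewrite -natr1; ring.
Qed.

Lemma valN x : w (- x) = w x.
Proof.
have H1 : w (-1) = 0%:E.
  have [q E] : exists q : rat, w (-1) = q%:E by apply: val_fin; rewrite oppr_eq0 oner_neq0.
  have := valM E E; rewrite mulrNN mulr1 val1 E => -[] H.
  by congr (_%:E); lra.
by rewrite -mulN1r (valuation_mul w_val) H1 add0e.
Qed.

Lemma valB x y : w (x - y) = w (y - x).
Proof. by rewrite -valN opprB. Qed.

Lemma val_geD x y (a : \bar rat) : (a <= w x -> a <= w y -> a <= w (x + y)%R)%E.
Proof.
move=> ax ay; apply: le_trans (valuation_add w_val x y).
by rewrite le_min ax ay.
Qed.

Lemma val_gtD x y (a : \bar rat) : (a < w x -> a < w y -> a < w (x + y)%R)%E.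
Proof.
move=> ax ay; apply: lt_le_trans (valuation_add w_val x y).
by rewrite lt_min ax ay.
Qed.

Lemma val_geM x y (a b : rat) :
  (a%:E <= w x -> b%:E <= w y -> (a + b)%:E <= w (x * y)%R)%E.
Proof. by move=> ax bx; rewrite (valuation_mul w_val) EFinD leeD. Qed.

Lemma val_gtM x y (a b : rat) :
  (a%:E < w x -> b%:E <= w y -> (a + b)%:E < w (x * y)%R)%E.
Proof.
have [->|x0] := eqVneq x 0; first by rewrite mul0r val0 !ltry.
have [->|y0] := eqVneq y 0; first by rewrite mulr0 val0 !ltry.
have [i Ei] := val_fin x0; have [j Ej] := val_fin y0.
by rewrite (valM Ei Ej) Ei Ej !lte_fin !lee_fin; lra.
Qed.

Lemma val_ge0M x y : (0%:E <= w x -> 0%:E <= w y -> 0%:E <= w (x * y)%R)%E.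
Proof. by move=> x0 y0; have := val_geM x0 y0; rewrite addr0. Qed.

Lemma val_geX x n : (0%:E <= w x -> 0%:E <= w (x ^+ n)%R)%E.
Proof.
move=> x0; elim: n => [|n IH]; first by rewrite expr0 val1.
by rewrite exprS; have := val_geM x0 IH; rewrite addr0.
Qed.

Lemma val_nat n : (0%:E <= w n%:R)%E.
Proof.
elim: n => [|n IH]; first by rewrite val0 leey.
by rewrite -natr1; apply: val_geD => //; rewrite val1.
Qed.

Lemma val_gesum (I : Type) (s : seq I) (P : pred I) (G : I -> F) (a : \bar rat) :
  (forall i, P i -> a <= w (G i))%E -> (a <= w (\sum_(i <- s | P i) G i)%R)%E.
Proof.
move=> H; apply: (big_ind (fun x => (a <= w x)%E)) => //; first by rewrite val0 leey.
by move=> x y; apply: val_geD.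
Qed.

Lemma val_gtsum (I : Type) (s : seq I) (P : pred I) (G : I -> F) (a : rat) :
  (forall i, P i -> a%:E < w (G i))%E -> (a%:E < w (\sum_(i <- s | P i) G i)%R)%E.
Proof.
move=> H; apply: (big_ind (fun x => (a%:E < w x)%E)) => //; first by rewrite val0 ltry.
by move=> x y; apply: val_gtD.
Qed.

Lemma valD_eql x y : (w x < w y)%E -> w (x + y) = w x.
Proof.
move=> xy; apply/eqP; rewrite eq_le; apply/andP; split; last exact: val_geD (ltW xy).
rewrite leNgt; apply/negP => H.
suff : (w x < w x)%E by rewrite ltxx.
have E : x = (x + y) - y by rewrite addrK.
by rewrite {2}E; apply: val_gtD; rewrite ?valN.
Qed.

Lemma valD_neq x y : w x != w y -> w (x + y) = Order.min (w x) (w y).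
Proof.
rewrite neq_lt => /orP[] H; first by rewrite valD_eql // min_l // ltW.
by rewrite addrC valD_eql // min_r // ltW.
Qed.

Lemma val_root x (a : rat) n : (0 < n)%N -> w (x ^+ n) = a%:E -> w x = (a / n%:R)%:E.
Proof.
move=> n0 E; have x0 : x != 0.
  by have := val_neq0 E; rewrite expf_eq0 n0.
have [b Eb] := val_fin x0; rewrite (valX n Eb) in E; case: E => <-.
by rewrite Eb; congr (_%:E); rewrite mulrC mulKf // pnatr_eq0 -lt0n.
Qed.

Lemma val_root_ge0 x n : (0 < n)%N -> (0%:E <= w (x ^+ n))%E -> (0%:E <= w x)%E.
Proof.
have [->|x0] := eqVneq x 0; first by rewrite val0 leey.
have [b Eb] := val_fin x0; rewrite (valX n Eb) Eb !lee_fin => n0.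
by rewrite pmulr_rge0 // ltr0n.
Qed.

Lemma val_root_gt0 x n : (0 < n)%N -> (0%:E < w (x ^+ n))%E -> (0%:E < w x)%E.
Proof.
have [->|x0] := eqVneq x 0; first by rewrite val0 ltry.
have [b Eb] := val_fin x0; rewrite (valX n Eb) Eb !lte_fin => n0.
by rewrite pmulr_rgt0 // ltr0n.
Qed.

(** The valuation of a product is a sum, whose least summand is at most the average. *)
Lemma val_prod_le (s : seq F) (P : rat) : s != [::] -> w (\prod_(x <- s) x) = P%:E ->
  exists2 x, x \in s & exists2 a : rat, w x = a%:E & (size s)%:R * a <= P.
Proof.
elim: s P => // x s IH P _; rewrite big_cons => E.
have := val_neq0 E; rewrite mulf_eq0 negb_or => /andP[x0 s0].
have [a Ea] := val_fin x0; have [b Eb] := val_fin s0.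
move: E; rewrite (valM Ea Eb) => -[] <-.
have [sn|sn] := eqVneq s [::].
  exists x; rewrite ?mem_head //; exists a => //.
  by move: Eb; rewrite sn big_nil val1 => -[] <-; rewrite mul1r addr0.
have [y ys [d Ed Hd]] := IH _ sn Eb.
rewrite /= -natr1; have [ad|da] := leP a d.
  exists x; rewrite ?mem_head //; exists a => //.
  have : (size s)%:R * a <= (size s)%:R * d by rewrite ler_wpM2l.
  lra.
by exists y; rewrite ?inE ?ys ?orbT //; exists d => //; lra.
Qed.

(** By induction the sum of the tail has the valuation of one of its terms, which differs from that
    of the head, so nothing cancels. *)
Lemma val_sum_distinct (I : eqType) (s : seq I) (G : I -> F) : s != [::] -> uniq s ->
  {in s, forall i, G i != 0} ->
  {in s &, forall i j, w (G i) = w (G j) -> i = j} ->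
  exists2 i, i \in s & w (\sum_(i <- s) G i) = w (G i).
Proof.
elim: s => // x s IH _ /= /andP[xs us] G0 Gi.
rewrite big_cons; have [sn|sn] := eqVneq s [::].
  by exists x; rewrite ?mem_head // sn big_nil addr0.
have [||y ys Ey] := IH sn us.
- by move=> i si; apply: G0; rewrite inE si orbT.
- by move=> i j si sj; apply: Gi; rewrite inE ?si ?sj orbT.
have yxs : y \in x :: s by rewrite inE ys orbT.
have xy : w (G x) != w (G y).
  apply/eqP => /Gi H; move: xs; rewrite H ?mem_head ?ys //.
rewrite valD_neq ?Ey // minElt; case: ifP => _; last by exists y.
by exists x; rewrite ?mem_head.
Qed.

End Valuation.

(** * Roots of unity, [p]-power maps and preimages of nearby points in mixed characteristic *)

Section MixedCharacteristic.

Variables (F : closedFieldType) (w : F -> \bar rat) (p : nat).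
Hypotheses (w_val : is_valuation w) (p_prime : prime p) (wp : w p%:R = 1%:E).

Lemma val_pX r : w (p ^ r)%:R = r%:R%:E.
Proof. by rewrite natrX (valX w_val r wp) mulr1. Qed.

(** Bezout gives [km * m = kn * p + 1], of valuation 0 since [w p > 0]; both factors on the left
    have nonnegative valuation. *)
Lemma val_coprime m : ~~ (p %| m)%N -> w m%:R = 0%:E.
Proof.
move=> pm; have m0 : (0 < m)%N by case: m pm => //; rewrite dvdn0.
have /eqP cop : coprime m p by rewrite coprime_sym prime_coprime.
case: (egcdnP p m0) => km kn E _; rewrite cop in E.
have E1 : w (km * m)%:R = 0%:E.
  rewrite E addnC natrD (valD_eql w_val) ?(val1 w_val) //.
  rewrite natrM mulrC; apply: lt_le_trans (_ : (1 + 0)%:E <= _)%E; last first.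
    by apply: val_geM => //; [rewrite wp | exact: val_nat].
  by rewrite addr0 lte_fin.
have : (km * m)%:R != 0 :> F by exact: val_neq0 E1.
rewrite natrM mulf_eq0 negb_or => /andP[k0 n0].
have [a Ea] := val_fin w_val k0; have [b Eb] := val_fin w_val n0.
have := val_nat w_val km; have := val_nat w_val m.
move: E1; rewrite natrM (valM w_val Ea Eb) Ea Eb !lee_fin => -[] H1 H2 H3.
by congr (_%:E); lra.
Qed.

(* 1 + X + ... + X^(n-1) takes the value n at 1 and is the product of the X - z
   over the z <> 1 with z^n = 1. *)
Lemma unity_root_val n (a : rat) : (1 < n)%N -> w n%:R = a%:E ->
  exists z, z ^+ n = 1 /\
    exists2 b : rat, w (1 - z) = b%:E & 0 <= b /\ n.-1%:R * b <= a.
Proof.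
case: n => // n n1 En; pose P : {poly F} := \poly_(i < n.+1) 1.
have szP : size P = n.+1 by rewrite size_poly_eq ?oner_neq0.
have lcP : lead_coef P = 1 by rewrite lead_coef_poly ?oner_neq0.
have EP x : P.[x] = \sum_(i < n.+1) x ^+ i.
  by rewrite horner_poly; apply: eq_bigr => i _; rewrite mul1r.
have [s Es] := closed_field_poly_normal P; rewrite lcP scale1r in Es.
have szs : size s = n by apply: succn_inj; rewrite -szP Es size_prod_XsubC.
have P1 : n.+1%:R = \prod_(x <- [seq 1 - x | x <- s]) x.
  transitivity P.[1].
    by rewrite EP (eq_bigr (fun=> 1)) => [|i _]; rewrite ?expr1n // sumr_const card_ord.
  rewrite Es horner_prod big_map; apply: eq_bigr => i _.
  by rewrite hornerXsubC.
have [||y] := @val_prod_le _ _ w_val [seq 1 - x | x <- s] a.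
- by rewrite -size_eq0 size_map szs -lt0n.
- by rewrite -P1.
case/mapP => z zs -> [b Eb Hb]; rewrite size_map szs in Hb.
have zn : z ^+ n.+1 = 1.
  apply/eqP; rewrite -subr_eq0 subrX1 -EP.
  suff /rootP -> : root P z by rewrite mulr0.
  by rewrite Es root_prod_XsubC.
exists z; split=> //; exists b => //; split=> //.
rewrite -lee_fin -Eb; apply: val_geD => //; first by rewrite (val1 w_val).
by rewrite (valN w_val); apply: (val_root_ge0 w_val (ltn0Sn n)); rewrite zn (val1 w_val).
Qed.

(** As [m] is a unit, the bound reads [(m - 1) b <= 0] and leaves only [b = 0]. Such roots serve to
    move a point out of the residue class of [- c]. *)
Lemma unity_root_val0 m : (1 < m)%N -> ~~ (p %| m)%N ->
  exists2 z, z ^+ m = 1 & w (1 - z) = 0%:E.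
Proof.
move=> m1 pm; have [z [zm [b Eb [b0 mb]]]] := unity_root_val m1 (val_coprime pm).
exists z => //; rewrite Eb; congr (_%:E); apply/eqP; rewrite eq_le b0 andbT.
by rewrite pmulr_rle0 // in mb; rewrite ltr0n; case: (m) m1 => [|[]].
Qed.

Lemma freshman_prime y u : (0%:E <= w y)%E -> (0%:E <= w u)%E ->
  exists2 t, (0%:E <= w t)%E & (y + u) ^+ p = y ^+ p + u ^+ p + p%:R * u * t.
Proof.
move=> y0 u0; case: (p) p_prime => [|[|k]] // pr.
(* The prime, now [k.+2], divides the middle binomial coefficients, and every middle term contains
   [u]; [t] collects the cofactors. *)
pose t := \sum_(i < k.+1) (y ^+ (k.+1 - i) * u ^+ i * ('C(k.+2, i.+1) %/ k.+2)%:R).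
exists t.
  apply: val_gesum => // i _; apply: (val_ge0M w_val); last exact: val_nat.
  by apply: (val_ge0M w_val); apply: val_geX.
rewrite exprDn big_ord_recl big_ord_recr /= subn0 bin0 expr0 mulr1 mulr1n.
rewrite /bump /= !add1n subnn expr0 mul1r binn mulr1n.
rewrite -addrA; congr (_ + _); rewrite addrC; congr (_ + _).
rewrite mulr_sumr; apply: eq_bigr => i _.
rewrite /bump /= add1n subSS.
have /divnK pC : (k.+2 %| 'C(k.+2, i.+1))%N.
  by apply: prime_dvd_bin => //; rewrite /= ltnS ltn_ord.
rewrite -[in LHS]pC -mulr_natl natrM.
by rewrite !exprS; ring.
Qed.

Lemma freshman r y u : (0%:E <= w y)%E -> (0%:E <= w u)%E ->
  exists2 t, (0%:E <= w t)%E &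
    (y + u) ^+ (p ^ r) = y ^+ (p ^ r) + u ^+ (p ^ r) + p%:R * u * t.
Proof.
move=> y0 u0; elim: r => [|r [t Ht E]].
  by exists 0; rewrite ?(val0 w_val) ?leey // !expn0 !expr1 mulr0 addr0.
set q := (p ^ r)%N in E *; have q0 : (0 < q)%N by rewrite expn_gt0 prime_gt0.
have [t1 Ht1 E1] := freshman_prime (val_geX w_val q y0) (val_geX w_val q u0).
have wA : (0%:E <= w (y ^+ q + u ^+ q))%E by apply: val_geD => //; apply: val_geX.
have wB : (0%:E <= w ((y + u) ^+ q))%E by apply: val_geX => //; apply: val_geD.
(* The first summand comes from factoring the difference of the [p]-th powers of [(y + u) ^+ q] and
   [y ^+ q + u ^+ q], which differ by [p u t]; the second is the error for [y ^+ q] and [u ^+ q]. *)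
exists (t * \sum_(i < p) ((y + u) ^+ q) ^+ (p.-1 - i) * (y ^+ q + u ^+ q) ^+ i
        + u ^+ q.-1 * t1).
  apply: val_geD => //; apply: (val_ge0M w_val) => //; last exact: val_geX.
  by apply: val_gesum => // i _; apply: (val_ge0M w_val); apply: val_geX.
rewrite expnSr !exprM -/q -[LHS](subrK ((y ^+ q + u ^+ q) ^+ p)) subrXX E1.
rewrite {1}E; have -> : u ^+ q = u * u ^+ q.-1 by rewrite -exprS prednK.
ring.
Qed.

(** For [q = p ^ r] and [u = z - 1], expanding [(1 + u)^q = 1] gives [u^q = - p u t], so [w u > 0].
    The upper bound is that of [unity_root_val], as [p ^ r] has valuation [r]. *)
Lemma unity_root_p r : (0 < r)%N ->
  exists z, z ^+ (p ^ r) = 1 /\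
    exists2 b : rat, w (1 - z) = b%:E & 0 < b /\ (p ^ r).-1%:R * b <= r%:R.
Proof.
move=> r0; have q1 : (1 < p ^ r)%N by rewrite -{1}(expn0 p) ltn_exp2l ?prime_gt1.
have [z [zq [b Eb [b0 rb]]]] := unity_root_val q1 (val_pX r).
exists z; split=> //; exists b => //; split=> //.
have wu : (0%:E <= w (z - 1))%E by rewrite (valB w_val) Eb lee_fin.
have w1 : (0%:E <= w 1)%E by rewrite (val1 w_val).
have [t t0] := freshman r w1 wu.
have -> : 1 + (z - 1) = z by ring.
rewrite expr1n zq => H.
have E : (z - 1) ^+ (p ^ r) = - (p%:R * (z - 1) * t).
  by apply: (addrI 1); apply/eqP; rewrite -subr_eq opprK -H.
rewrite -lte_fin -Eb (valB w_val); apply: (val_root_gt0 w_val (ltnW q1)).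
rewrite E (valN w_val).
apply: lt_le_trans (_ : (1 + 0 + 0)%:E <= _)%E; first by rewrite lte_fin.
by apply: val_geM => //; apply: val_geM => //; rewrite wp.
Qed.

(** With [q = p ^ r] and [u = x - y], one has [u^q = (x^q - y^q) - p u t]. The error has valuation
    greater than [1 >= d], and [x^q - y^q] agrees with [x0 - y0] up to a unit; hence
    [q w(u) = d]. *)
Lemma preimage_step r m y y0 x0 c (d : rat) :
  let l := (p ^ r * m)%N in
  (0 < m)%N -> ~~ (p %| m)%N ->
  y ^+ l = y0 + c -> (0%:E <= w y)%E -> m = 1%N \/ w y = 0%:E ->
  w (y0 - x0) = d%:E -> 0 < d <= 1 ->
  exists2 x, x ^+ l = x0 + c & w (y - x) = (d / (p ^ r)%:R)%:E.
Proof.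
move=> l m0 pm Ey wy mw Ed /andP[d0 d1].
have q0 : (0 < p ^ r)%N by rewrite expn_gt0 prime_gt0.
have l0 : (0 < l)%N by rewrite muln_gt0 q0.
have [x Ex xy] : exists2 x, x ^+ l = x0 + c & (0%:E < w (x - y))%E.
  (* The product of the y - z over the preimages z of x0 is y0 - x0. *)
  have [s Es] := closed_field_poly_normal ('X^l - (x0 + c)%:P : {poly F}).
  have /monicP lcP : ('X^l - (x0 + c)%:P : {poly F}) \is monic.
    by apply: monicXnsubC.
  rewrite lcP scale1r in Es.
  apply: contrapT => H; move: d0; apply/negP; rewrite -leNgt -lee_fin.
  have -> : d%:E = w (\prod_(z <- s) (y - z)).
    rewrite -Ed; congr w; transitivity ('X^l - (x0 + c)%:P).[y].
      by rewrite !hornerE Ey; ring.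
    by rewrite Es horner_prod; apply: eq_bigr => i _; rewrite hornerXsubC.
  rewrite big_seq; apply: (big_ind (fun z => w z <= 0%:E)%E) => [|z t z0 t0|z zs].
  - by rewrite (val1 w_val).
  - by rewrite (valuation_mul w_val) -[0%:E]adde0 leeD.
  rewrite leNgt; apply/negP => H1; apply: H; exists z; last by rewrite (valB w_val).
  apply/eqP; rewrite -subr_eq0.
  have : root ('X^l - (x0 + c)%:P : {poly F}) z by rewrite Es root_prod_XsubC.
  by rewrite /root !hornerE.
exists x => //; pose u := x - y; pose q := (p ^ r)%N; rewrite -/q in q0 *.
have wu : (0%:E < w u)%E := xy.
have [t t0] := freshman r wy (ltW wu).
rewrite -/q addrC subrK => Exq.
pose d1' := x ^+ q - y ^+ q.
have wd' : w d1' = d%:E.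
  have wx : (0%:E <= w x)%E by rewrite -[x](subrK y); apply: val_geD => //; exact: ltW.
  have dE : x0 - y0 = d1' * \sum_(i < m) (x ^+ q) ^+ (m.-1 - i) * (y ^+ q) ^+ i.
    rewrite -subrXX -!exprM -/l Ex Ey; ring.
  (* The sum is 1 if [m = 1]. Otherwise [x^q] and [y^q] agree modulo the maximal ideal, so it
     reduces to [m y^(q (m - 1))], a unit. *)
  have wS : w (\sum_(i < m) (x ^+ q) ^+ (m.-1 - i) * (y ^+ q) ^+ i) = 0%:E.
    case: mw => [->|wy0]; first by rewrite big_ord1 mul1r expr0 (val1 w_val).
    have wd1 : (0%:E < w d1')%E.
      have -> : d1' = u ^+ q + p%:R * u * t by rewrite /d1' Exq; ring.
      apply: val_gtD => //.
        have := val_gtM w_val wu (val_geX w_val q.-1 (ltW wu)).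
        by rewrite -exprS prednK // addr0.
      rewrite -mulrA; apply: lt_le_trans (_ : (1 + (0 + 0))%:E <= _)%E; first by rewrite lte_fin.
      by apply: val_geM => //; [rewrite wp | apply: val_geM => //; exact: ltW].
    have -> : \sum_(i < m) (x ^+ q) ^+ (m.-1 - i) * (y ^+ q) ^+ i =
      m%:R * (y ^+ q) ^+ m.-1 +
      \sum_(i < m) ((x ^+ q) ^+ (m.-1 - i) - (y ^+ q) ^+ (m.-1 - i)) * (y ^+ q) ^+ i.
      transitivity (\sum_(i < m) (y ^+ q) ^+ m.-1 +
         \sum_(i < m) ((x ^+ q) ^+ (m.-1 - i) - (y ^+ q) ^+ (m.-1 - i)) * (y ^+ q) ^+ i).
        rewrite -big_split /=; apply: eq_bigr => i _.
        have {2}-> : m.-1 = (m.-1 - i + i)%N by have := ltn_ord i; lia.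
        by rewrite exprD; ring.
      by rewrite sumr_const card_ord mulr_natl.
    have wA : w (m%:R * (y ^+ q) ^+ m.-1) = 0%:E.
      rewrite (valM w_val (val_coprime pm) (valX w_val _ (valX w_val q wy0))).
      by rewrite !mulr0 addr0.
    rewrite (valD_eql w_val) wA //; apply: val_gtsum => // i _.
    rewrite -[0]addr0; apply: val_gtM => //; last by do 2!apply: val_geX => //.
    rewrite subrXX -[0]addr0; apply: val_gtM => //.
    by apply: val_gesum => // j _; apply: val_ge0M => //; do 2!apply: val_geX => //.
  have : d1' != 0.
    apply/eqP => d10; move: Ed; rewrite (valB w_val) dE d10 mul0r (val0 w_val) //.
  move=> /(val_fin w_val)[a Ea]; rewrite Ea; congr (_%:E).
  by move: Ed; rewrite (valB w_val) dE (valM w_val Ea wS) addr0 => -[].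
have wuq : w (u ^+ q) = d%:E.
  have -> : u ^+ q = d1' + - (p%:R * u * t) by rewrite /d1' Exq; ring.
  rewrite (valD_eql w_val) wd' // (valN w_val).
  apply: le_lt_trans (_ : 1%:E < _)%E; first by rewrite lee_fin.
  rewrite -mulrA mulrC -[1]add0r; apply: val_gtM => //; last by rewrite wp.
  by rewrite -[0]addr0; apply: val_gtM.
by rewrite (valB w_val); apply: val_root.
Qed.

End MixedCharacteristic.

(** * Finitely generated algebraic extensions through matrices over the base field *)

Section Adjoin.

Variables (K L : fieldType) (iota : {rmorphism K -> L}).

(* Multiplication by x preserves the K-span of the entries of e, so that x is an
   eigenvalue of a matrix over K if e <> 0. *)
Definition preserves_span n (e : 'rV[L]_n) (x : L) :=
  exists M : 'M[K]_n, x *: e = e *m map_mx iota M.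

Lemma preserves_spanB n (e : 'rV[L]_n) x y :
  preserves_span e x -> preserves_span e y -> preserves_span e (x - y).
Proof.
by move=> [M EM] [N EN]; exists (M - N); rewrite map_mxB mulmxBr -EM -EN scalerBl.
Qed.

Lemma preserves_spanM n (e : 'rV[L]_n) x y :
  preserves_span e x -> preserves_span e y -> preserves_span e (x * y).
Proof.
move=> [M EM] [N EN]; exists (M *m N).
by rewrite map_mxM mulmxA -EM -scalemxAl -EN scalerA.
Qed.

Lemma preserves_span_iota n (e : 'rV[L]_n) a : preserves_span e (iota a).
Proof. by exists a%:M; rewrite map_scalar_mx mul_mx_scalar. Qed.

(** The row consists of the powers [1, b, ..., b^d], where [d + 1] is the degree of an annihilating
    polynomial. Its entry 1 keeps products with other rows nonzero. *)
Lemma preserves_span_alg b : algebraicOver iota b ->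
  exists d (r : 'rV[L]_d.+1), r 0 0 = 1 /\ preserves_span r b.
Proof.
move=> [P P0 Pb]; case szP : (size P) => [|[|d]].
- by move/eqP : szP P0; rewrite size_poly_eq0 => ->.
- move/eqP/size_poly1P : szP Pb => [a a0 ->].
  by rewrite map_polyC /= rootC fmorph_eq0 (negbTE a0).
exists d, (\row_j b ^+ j); split; first by rewrite mxE.
have lP : P`_d.+1 != 0 by rewrite -[d.+1]/(d.+2.-1) -szP -lead_coefE lead_coef_eq0.
(* The companion matrix: the last column rewrites [b^(d+1)] by means of [P], made monic. *)
exists (\matrix_(i, j) if (j < d)%N then (i == j.+1 :> nat)%:R else - (P`_i / P`_d.+1)).
apply/rowP => j; rewrite !mxE.
have [jd|dj] := ltnP j d.
  have j1 : (j.+1 < d.+1)%N by [].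
  rewrite (bigD1 (Ordinal j1)) //= !mxE jd eqxx rmorph1 mulr1 big1 ?addr0 ?exprS //.
  move=> i ij; rewrite !mxE jd; case: eqP => [E|]; last by rewrite rmorph0 mulr0.
  by case/eqP: ij; apply: val_inj.
have -> : (j : nat) = d by apply/eqP; rewrite eqn_leq dj -ltnS ltn_ord.
have lP' : iota P`_d.+1 != 0 by rewrite fmorph_eq0.
apply: (mulIf lP'); move/rootP : Pb.
rewrite horner_coef size_map_poly szP big_ord_recr /= coef_map /= => /eqP.
rewrite addrC addr_eq0 -exprS mulrC => /eqP ->; rewrite -sumrN mulr_suml.
apply: eq_bigr => i _; rewrite !mxE ltnNge dj /= coef_map /= rmorphN fmorph_div.
by field.
Qed.

(** The row [f] lists the products [e_i r_j], on which matrices act through either factor; those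
    with [j = 0] are the entries of [e]. *)
Lemma preserves_span_tensor m d (e : 'rV[L]_m) (r : 'rV[L]_d.+1) :
  e != 0 -> r 0 0 = 1 ->
  exists n (f : 'rV[L]_n), f != 0 /\
    forall x, preserves_span e x \/ preserves_span r x -> preserves_span f x.
Proof.
move=> e0 r1; exists (m * d.+1)%N, (mxvec (e^T *m r)); split.
  apply: contraNneq e0 => /(congr1 (@vec_mx _ _ _)); rewrite mxvecK linear0 => E.
  apply/eqP/rowP => i; move/matrixP/(_ i 0) : E.
  by rewrite !mxE big_ord1 !mxE r1 mulr1.
move=> x [] [M EM].
  exists (lin_mulmx M^T).
  rewrite (map_lin_mx (gf := mulmx (map_mx iota M^T))); last by move=> A; rewrite map_mxM.
  rewrite mul_vec_lin /= mulmxA -map_trmx -trmx_mul -EM.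
  by rewrite linearZ /= -scalemxAl linearZ.
exists (lin_mulmxr M).
rewrite (map_lin_mx (gf := mulmxr (map_mx iota M))); last by move=> A; rewrite /= map_mxM.
by rewrite mul_vec_lin /= -mulmxA -EM -scalemxAr linearZ.
Qed.

Lemma preserves_span_seq (s : seq L) : {in s, forall x, algebraicOver iota x} ->
  exists n (e : 'rV[L]_n), e != 0 /\ {in s, forall x, preserves_span e x}.
Proof.
elim: s => [|b s IH] algs.
  by exists 1%N, 1; split=> //; apply: oner_neq0.
have [|m [e [e0 es]]] := IH; first by move=> x xs; apply: algs; rewrite inE xs orbT.
have [d [r [r1 rb]]] := preserves_span_alg (algs b (mem_head b s)).
have [n [f [f0 fP]]] := preserves_span_tensor e0 r1.
exists n, f; split=> // x; rewrite inE => /orP[/eqP ->|xs]; apply: fP; first by right.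
by left; apply: es.
Qed.

(** [x] is a root of the characteristic polynomial of its matrix, whose degree does not depend on
    [x]. *)
Lemma preserves_span_root n (e : 'rV[L]_n) x : e != 0 -> preserves_span e x ->
  exists P : {poly K}, size P = n.+1 /\ root (map_poly iota P) x.
Proof.
move=> e0 [M EM]; exists (char_poly M); split; first exact: size_char_poly.
rewrite map_char_poly -eigenvalue_root_char; apply/eigenvalueP.
by exists e => //; rewrite -EM.
Qed.

Lemma adjoin_iota (S : set L) a : adjoin iota S (iota a).
Proof. by apply: sub_gen_smallest; left; exists a. Qed.

Lemma adjoin_gen (S : set L) x : S x -> adjoin iota S x.
Proof. by move=> Sx; apply: sub_gen_smallest; right. Qed.

Lemma adjoin_closed (S : set L) : GRing.divring_closed [in adjoin iota S].
Proof.
split=> [|x y|x y]; rewrite !inE.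
- by rewrite -(rmorph1 iota); apply: adjoin_iota.
- move=> Sx Sy M [[M1 MB MD] SM].
  have := MB x y; rewrite !inE; apply.
    by apply: Sx; split.
  by apply: Sy; split.
- move=> Sx Sy M [[M1 MB MD] SM].
  have := MD x y; rewrite !inE; apply.
    by apply: Sx; split.
  by apply: Sy; split.
Qed.

(** The elements preserving the span form a ring containing [K] and [S], and its fractions form a
    field. *)
Lemma adjoin_frac n (e : 'rV[L]_n) (S : set L) : (forall x, S x -> preserves_span e x) ->
  forall x, adjoin iota S x -> exists a b,
    [/\ preserves_span e a, preserves_span e b, b != 0 & x = a / b].
Proof.
move=> Se; apply: (@smallest_sub _ _ _ [set x | exists a b,
  [/\ preserves_span e a, preserves_span e b, b != 0 & x = a / b]]); last first.
  have frac1 y : preserves_span e y -> exists a b,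
    [/\ preserves_span e a, preserves_span e b, b != 0 & y = a / b].
    move=> ey; exists y, 1; split; rewrite ?oner_neq0 ?divr1 //.
    by rewrite -(rmorph1 iota); apply: preserves_span_iota.
  move=> y [[a _ <-]|/Se ey]; apply: frac1 => //; exact: preserves_span_iota.
split=> [|y z|y z]; rewrite !inE /=.
- exists 1, 1; split; rewrite ?oner_neq0 ?divr1 //;
    by rewrite -(rmorph1 iota); apply: preserves_span_iota.
- move=> [a [b [ea eb b0 ->]]] [c [d [ec ed d0 ->]]].
  exists (a * d - c * b), (b * d); split.
  + by apply: preserves_spanB; apply: preserves_spanM.
  + exact: preserves_spanM.
  + by rewrite mulf_neq0.
  + by field; rewrite b0 d0.
- move=> [a [b [ea eb b0 ->]]] [c [d [ec ed d0 ->]]].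
  (* Division by 0 gives 0 by convention and needs its own fraction. *)
  have [->|c0] := eqVneq c 0.
    exists 0, b; split=> //; last by rewrite !mul0r invr0 mulr0.
    by rewrite -(rmorph0 iota); apply: preserves_span_iota.
  exists (a * d), (b * c); split; try exact: preserves_spanM.
    by rewrite mulf_neq0.
  by field; rewrite b0 c0 d0.
Qed.

End Adjoin.

(** * Cyclic subgroups of the rationals and their cosets *)

Section RamificationIndex.

Lemma int_mul_closed (G : set rat) x : G 0 ->
  (forall x y, G x -> G y -> G (x - y)) -> G x -> forall j : int, G (x *~ j).
Proof.
move=> G0 GB Gx; have GN y : G y -> G (- y) by move=> Gy; rewrite -sub0r; apply: GB.
have Gn (n : nat) : G (x *+ n).
  elim: n => [|n IH]; first by rewrite mulr0n.
  by rewrite mulrSr -{2}(opprK x); apply: GB => //; apply: GN.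
by case=> n; [|rewrite NegzE mulrNz; apply: GN]; apply: Gn.
Qed.

(** [G] lies between [gZ] and [(g/N)Z], so it is infinite cyclic, and its generator divides [g]. *)
Lemma subgroup_cyclic (G : set rat) (g : rat) (N : nat) : 0 < g -> (0 < N)%N ->
  G g -> (forall x y, G x -> G y -> G (x - y)) ->
  (forall x, G x -> exists j : int, N%:R * x = g *~ j) ->
  exists2 e : nat, (0 < e)%N & G = range (fun j : int => (g / e%:R) *~ j).
Proof.
move=> g0 N0 Gg GB GN; have G0 : G 0 by rewrite -(subrr g); apply: GB.
have N0' : N%:R != 0 :> rat by rewrite pnatr_eq0 -lt0n.
(* The generator is g / N times the least positive such i. *)
pose P i := (0 < i)%N && `[< G (g / N%:R * i%:R) >].
have exP : exists i, P i.
  by exists N; rewrite /P N0; apply/asboolP; rewrite divfK.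
have [m /andP[m0 /asboolP Gm] min_m] := ex_minnP exP.
set h := g / N%:R * m%:R in Gm.
have Gh j := int_mul_closed G0 GB Gm j.
have h0 : 0 < h by rewrite mulr_gt0 ?divr_gt0 ?ltr0n.
have hG x : G x -> exists j : int, x = h *~ j.
  move=> Gx; have [j Ej] := GN x Gx.
  have Ex : x = g / N%:R * j%:~R.
    by apply: (mulfI N0'); rewrite Ej -mulrzr; field.
  have m0' : (m%:Z != 0) by case: (m) m0.
  (* The remainder of [j] modulo [m] yields an element of [G], which the minimality of [m] forces to
     be 0. *)
  have rx : x - h *~ (j %/ m)%Z = g / N%:R * ((j %% m)%Z)%:~R.
    rewrite Ex {1}(divz_eq j m) -mulrzr /h rmorphD rmorphM /= -pmulrn; ring.
  have := modz_ge0 j m0'; have := ltz_mod j m0'.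
  case Er : (j %% m)%Z rx => [r|//] rx rm _.
  have Gr : G (g / N%:R * r%:R) by rewrite pmulrn -rx; apply: GB.
  exists (j %/ m)%Z; apply/eqP; rewrite -subr_eq0 rx.
  have [->|r0] := posnP r; first by rewrite mulr0.
  have /min_m : P r by rewrite /P r0; apply/asboolP.
  by move: rm; rewrite ger0_norm // ltz_nat ltnNge => /negbTE ->.
have [e Ee] := hG g Gg.
have e0 : 0 < e by have := g0; rewrite Ee -mulrzr pmulr_rgt0 // ltr0z.
case: e Ee e0 => // e Ee e0; exists e => //.
have -> : g / e%:R = h.
  by rewrite Ee -mulrzr -pmulrn mulfK // pnatr_eq0 -lt0n.
by apply/seteqP; split=> [x /hG[j ->]|x [j _ <-]]; [exists j|].
Qed.

(** The multiples [i g / e] with [0 <= i < e] represent each coset exactly once. *)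
Lemma card_cosets (g : rat) (e : nat) : 0 < g -> (0 < e)%N ->
  #|` fset_set [set [set r | range (fun j : int => g *~ j) (r - q)]
                | q in range (fun j : int => (g / e%:R) *~ j)] | = e.
Proof.
move=> g0 e0; have e0' : e%:R != 0 :> rat by rewrite pnatr_eq0 -lt0n.
have g0' : g != 0 by rewrite gt_eqF.
have ez : (e%:Z != 0) by case: (e) e0.
pose coset q := [set r | range (fun j : int => g *~ j) (r - q)].
have Ecoset a b : coset a = coset b <-> range (fun j : int => g *~ j) (a - b).
  split=> [E|[j _ Ej]].
    have : coset a a by exists 0; rewrite ?subrr ?mulr0z.
    by rewrite E.
  apply/seteqP; split=> r [k _ Ek].
    by exists (k + j) => //; rewrite mulrzDr Ek Ej; ring.
  by exists (k - j) => //; rewrite mulrzBr Ek Ej; ring.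
apply: card_fset_set.
have -> : [set coset q | q in range (fun j : int => (g / e%:R) *~ j)] =
  (fun i : nat => coset (g / e%:R * i%:R)) @` `I_e.
  apply/seteqP; split=> [_ [_ [j _ <-] <-]|_ [i _ <-]]; last first.
    by exists (g / e%:R * i%:R) => //; exists i%:Z; rewrite // -mulrzr -pmulrn.
  exists (absz (j %% e)%Z).
    by have := ltz_mod j ez; rewrite /= -ltz_nat gez0_abs ?modz_ge0 // ger0_norm.
  apply/Ecoset; exists (- (j %/ e)%Z) => //.
  have -> : `|(j %% e)%Z|%:R = (j %% e)%Z%:~R :> rat.
    by rewrite pmulrn gez0_abs ?modz_ge0.
  have /(congr1 (fun k : int => k%:~R : rat)) := divz_eq j e.
  rewrite -(mulrzr g) -(mulrzr (g / _)) mulrNz rmorphD rmorphM /= -pmulrn => ->.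
  by field.
apply: inj_card_eq => i k; rewrite !inE /= => ie ke /Ecoset[j _].
rewrite -mulrzr => Ej.
have : (e%:Z * j = i%:Z - k%:Z).
  apply/eqP; rewrite -(eqr_int rat) rmorphM rmorphB /= -!pmulrn; apply/eqP.
  by apply: (mulfI g0'); rewrite mulrCA Ej; field.
have [j0|[j1|j1]] : j = 0 \/ 1 <= j \/ j <= -1 by lia.
- by rewrite j0 mulr0; lia.
- have := ler_wpM2l (ler0n int e) j1; rewrite natz; lia.
- have := ler_wpM2l (ler0n int e) j1; rewrite natz; lia.
Qed.

End RamificationIndex.

(** * Value groups in a tower of fields and powers of [p] in ramification indices *)

Section Tower.

Variables (K : fieldType) (v : K -> \bar rat) (g : rat).
Hypotheses (g_gt0 : 0 < g) (v_g : value_group v setT = range (fun n : int => g *~ n)).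
Variables (L : fieldType) (iota : {rmorphism K -> L}) (w : L -> \bar rat).
Hypotheses (w_val : is_valuation w) (w_ext : forall x, w (iota x) = v x).

Lemma value_group_base :
  value_group w (range iota) = range (fun n : int => g *~ n).
Proof.
rewrite -v_g; apply/seteqP; split=> q [x]; first by move=> [a _ <-]; exists a; rewrite -?w_ext.
by move=> _ Ex; exists (iota x); [exists x | rewrite w_ext].
Qed.

Lemma val_iota a : a != 0 -> exists j : int, w (iota a) = (g *~ j)%:E.
Proof.
move=> a0; have [q Eq] : exists q : rat, w (iota a) = q%:E.
  by apply: val_fin; rewrite ?fmorph_eq0.
have : value_group w (range iota) q by exists (iota a) => //; exists a.
by rewrite value_group_base => -[j _ Ej]; exists j; rewrite Eq Ej.
Qed.

(** Two monomials of equal valuation give [(i - j) a] in [gZ] with [0 < i - j <= n]; the factorial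
    is a multiple of every such difference. *)
Lemma val_root_poly (P : {poly K}) n x (a : rat) : size P = n.+1 ->
  root (map_poly iota P) x -> w x = a%:E ->
  exists j : int, (n`!)%:R * a = g *~ j.
Proof.
move=> szP Px Ex; have x0 := val_neq0 w_val Ex.
(* Two nonzero terms of the vanishing sum P(x) have the same valuation. *)
pose G (i : 'I_n.+1) := iota P`_i * x ^+ i.
pose s := [seq i : 'I_n.+1 <- enum 'I_n.+1 | P`_i != 0].
have Gval i : i \in s -> exists k : int, w (G i) = (g *~ k + i%:R * a)%:E.
  rewrite mem_filter => /andP[Pi _]; have [k Ek] := val_iota Pi.
  by exists k; rewrite (valM w_val Ek (valX w_val i Ex)).
have sum0 : \sum_(i <- s) G i = 0.
  rewrite big_filter big_enum_cond /= -[RHS](rootP Px) horner_coef size_map_poly szP.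
  rewrite big_mkcond; apply: eq_bigr => i _; rewrite /G coef_map /=.
  by case: eqP => //= ->; rewrite rmorph0 mul0r.
(* Were the valuations distinct, the sum would have a finite valuation, yet it is 0. *)
have [inj|H] := pselect (forall i j, i \in s -> j \in s -> w (G i) = w (G j) -> i = j).
  have [|||i si] := val_sum_distinct w_val (G := G) _ _ _ inj.
  - suff sm : ord_max \in s by apply/eqP => s0; rewrite s0 in sm.
    rewrite mem_filter mem_enum andbT /= -[n]/(n.+1.-1) -szP -lead_coefE lead_coef_eq0.
    by rewrite -size_poly_eq0 szP.
  - by rewrite filter_uniq // enum_uniq.
  - by move=> i /Gval[k Ek]; apply/eqP => Gi0; rewrite Gi0 (val0 w_val) in Ek.
  by have [k ->] := Gval _ si; rewrite sum0 (val0 w_val).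
have [i [j [si sj Eij nij]]] : exists i j, [/\ i \in s, j \in s, w (G i) = w (G j) & i <> j].
  apply: contrapT => H1; apply: H => i j si sj Eij; apply: contrapT => nij.
  by apply: H1; exists i, j.
have {si sj Eij} [k Ek] : exists k : int, (i%:R - j%:R) * a = g *~ k.
  have [k1 E1] := Gval i si; have [k2 E2] := Gval j sj.
  move: Eij; rewrite E1 E2 => -[] H1; exists (k2 - k1).
  rewrite mulrzBr mulrBl; lra.
wlog ij : i j k nij Ek / (j < i)%N => [wl|].
  have [|ij|ij] := ltngtP j i; first exact: (wl i j k).
    by apply: (wl j i (- k)) => //; [exact/nesym | rewrite mulrNz -Ek; ring].
  by case: nij; apply: val_inj.
have /dvdnP[t Et] : (i - j %| n`!)%N.
  by apply: dvdn_fact; have := ltn_ord i; lia.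
exists (k * t%:Z); rewrite Et natrM natrB ?(ltnW ij) // -mulrA Ek.
by rewrite mulrzA -pmulrn mulr_natl.
Qed.

(** Elements of [K(S)] are quotients of roots of polynomials of one common degree [n], so [n!]
    clears all denominators and [subgroup_cyclic] applies. *)
Lemma value_group_adjoin (S : set L) (s : seq L) :
  (forall x, algebraicOver iota x) -> (forall x, S x -> x \in s) ->
  exists2 e : nat, (0 < e)%N &
    value_group w (adjoin iota S) = range (fun j : int => (g / e%:R) *~ j).
Proof.
move=> alg Ss; have [n [r [r0 rs]]] := @preserves_span_seq _ _ iota s (fun x _ => alg x).
have [A1 AB AD] := @adjoin_closed _ _ iota S.
apply: (subgroup_cyclic g_gt0 (fact_gt0 n)).
- have : value_group w (range iota) g by rewrite value_group_base; exists 1.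
  by case=> x [a _ <-] Ea; exists (iota a) => //; apply: adjoin_iota.
- move=> qx qy [x Sx Ex] [y Sy Ey]; exists (x / y).
    by have := AD x y; rewrite !inE; apply.
  have y0 := val_neq0 w_val Ey.
  have [b Eb] : exists b : rat, w (x / y) = b%:E.
    by apply: val_fin => //; rewrite mulf_neq0 ?invr_eq0 // (val_neq0 w_val Ex).
  have := valM w_val Eb Ey; rewrite divfK // Ex Eb => -[] ->.
  by rewrite addrK.
move=> q [x /(adjoin_frac (fun x Sx => rs x (Ss x Sx)))[a [b [ra rb b0 ->]]]] Ex.
have a0 : a != 0 by have := val_neq0 w_val Ex; rewrite mulf_eq0 negb_or => /andP[].
have [qa Ea] := val_fin w_val a0; have [qb Eb] := val_fin w_val b0.
have [P [szP Pa]] := preserves_span_root r0 ra.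
have [Q [szQ Qb]] := preserves_span_root r0 rb.
have [i Ei] := val_root_poly szP Pa Ea; have [j Ej] := val_root_poly szQ Qb Eb.
have := valM w_val Ex Eb; rewrite divfK // Ea => -[] H.
by exists (i - j); rewrite mulrzBr -Ei -Ej H; ring.
Qed.

Lemma ramification_index_mul (S : set L) (s : seq L) :
  (forall x, algebraicOver iota x) -> (forall x, S x -> x \in s) ->
  (0 < ramification_index iota w (adjoin iota S))%N /\
  forall x (a : rat), adjoin iota S x -> w x = a%:E ->
    exists j : int, (ramification_index iota w (adjoin iota S))%:R * a = g *~ j.
Proof.
move=> alg Ss; have [e e0 E] := value_group_adjoin alg Ss.
rewrite /ramification_index E value_group_base card_cosets //; split=> // x a Sx Ex.
have : value_group w (adjoin iota S) a by exists x.
rewrite E => -[j _ <-]; exists j.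
by rewrite -(mulrzr (g / _)) -(mulrzr g); field; rewrite pnatr_eq0 -lt0n.
Qed.

(** If [e] is the index, [e d / N^k] lies in [gZ], so [p^k] divides [e] times the numerator of
    [d / g], which does not vary with [k]. *)
Lemma wildly_ramified_of_val (p N : nat) (S : nat -> set L) (d : rat) :
  prime p -> (0 < N)%N -> (p %| N)%N -> d != 0 ->
  (forall x, algebraicOver iota x) ->
  (forall n, exists s : seq L, forall x, S n x -> x \in s) ->
  (forall k, exists n, exists2 x, adjoin iota (S n) x & w x = (d / (N ^ k)%:R)%:E) ->
  infinitely_wildly_ramified iota w p (fun n => adjoin iota (S n)).
Proof.
move=> pp N0 pN d0 alg fin val B.
set u := d / g; have u0 : u != 0 by rewrite mulf_neq0 ?invr_eq0 // gt_eqF.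
have nu0 : (0 < `|numq u|)%N by rewrite absz_gt0 numq_eq0.
(* The second summand absorbs the powers of [p] in the numerator, leaving [p^B > B] for the
   index. *)
have [n [x Sx Ex]] := val (B + logn p `|numq u|)%N.
set k := (B + _)%N in Ex; exists n.
have [s Ss] := fin n; have [e0 ePx] := ramification_index_mul alg Ss.
set e := ramification_index _ _ _ in e0 ePx *.
have [j Ej] := ePx _ _ Sx Ex.
have Nk0 : (N ^ k)%:R != 0 :> rat by rewrite pnatr_eq0 -lt0n expn_gt0 N0.
have Eint : e%:Z * numq u = j * denq u * (N ^ k)%:Z.
  apply/eqP; rewrite -(eqr_int rat) !rmorphM /= -!pmulrn; apply/eqP.
  have Eu : u * (denq u)%:~R = (numq u)%:~R.
    by rewrite -{1}(divq_num_den u) divfK // intr_eq0 denq_eq0.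
  have Ed : d = g * u by rewrite /u; field; rewrite gt_eqF.
  have : e%:R * u = j%:~R * (N ^ k)%:R :> rat.
    apply: (mulfI (lt0r_neq0 g_gt0)); rewrite mulrCA -Ed.
    rewrite -(mulrzr g) in Ej; rewrite mulrA -Ej; by field.
  by rewrite -Eu => H; rewrite mulrA H; ring.
have dvd : (p ^ k %| e * `|numq u|)%N.
  apply: dvdn_trans (dvdn_exp2r k pN) _.
  have /(congr1 absz) := Eint; rewrite !abszM /= => ->.
  exact: dvdn_mull.
have /= := dvd; rewrite pfactor_dvdn ?muln_gt0 ?e0 // lognM // leq_add2r => Be.
rewrite p_part; apply: leq_trans (ltn_expl B (prime_gt1 pp)) _.
by rewrite leq_exp2l // prime_gt1.
Qed.

End Tower.

(** * Small valuations along the backward orbit of [a] *)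

Section BackwardOrbit.

Variables (F : closedFieldType) (w : F -> \bar rat) (p r m : nat).
Hypotheses (w_val : is_valuation w) (p_prime : prime p) (wp : w p%:R = 1%:E).
Hypotheses (r_gt0 : (0 < r)%N) (pNm : ~~ (p %| m)%N).

Let q := (p ^ r)%N.
Let l := (q * m)%N.

Variables (c a : F).
Hypotheses (c_neq0 : c != 0) (c_int : (0%:E <= w c)%E).

Let f := unicritical l c.

Lemma horner_unicritical x : f.[x] = x ^+ l - c.
Proof. by rewrite /f /unicritical !hornerE. Qed.

Let m_gt0 : (0 < m)%N.
Proof. by case: m pNm => //; rewrite dvdn0. Qed.

Let q_gt1 : (1 < q)%N.
Proof. by rewrite -{1}(expn0 p) ltn_exp2l ?prime_gt1. Qed.

Let l_gt1 : (1 < l)%N.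
Proof. by rewrite /l; apply: leq_trans q_gt1 _; rewrite leq_pmulr. Qed.

Let l_gt0 : (0 < l)%N := ltnW l_gt1.

Lemma preimage_seq (n : nat) :
  exists s : seq F, forall x, iter n (horner f) x = a -> x \in s.
Proof.
elim: n => [|n [s IH]]; first by exists [:: a] => x /= ->; rewrite mem_head.
have roots (y : F) : exists t : seq F, forall x, x ^+ l = y -> x \in t.
  have [t Et] := closed_field_poly_normal ('X^l - y%:P : {poly F}).
  exists t => x xy; have : root ('X^l - y%:P : {poly F}) x.
    by rewrite /root !hornerE xy subrr.
  rewrite Et rootZ ?root_prod_XsubC // lead_coef_eq0 -size_poly_eq0.
  by rewrite size_XnsubC.
have [t Ht] := choice roots.
exists (flatten [seq t (y + c) | y <- s]) => x; rewrite iterSr => /IH xs.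
apply/flatten_mapP; exists (horner f x) => //; apply: Ht.
by rewrite horner_unicritical subrK.
Qed.

Variables (T : nat -> set F).
Hypothesis T_iter : forall n x, iter n (horner f) x = a -> T n x.
Hypothesis T_sub : forall n x y, T n x -> T n y -> T n (x - y).

(** The form required by [wildly_ramified_of_val]. [N] is [l] when the valuations of points shrink
    and [q] when their distances do. *)
Definition wild_valuations := exists d : rat, exists N : nat,
  [/\ d != 0, (0 < N)%N, (p %| N)%N &
    forall k, exists n, exists2 x, T n x & w x = (d / (N ^ k)%:R)%:E].

Let level n x := iter n (horner f) x = a.

Lemma level_preimage n x y : level n x -> y ^+ l = x + c -> level n.+1 y.
Proof. by move=> nx xy; rewrite /level iterSr horner_unicritical xy addrK. Qed.

Lemma preimage_exists x : exists y, y ^+ l = x + c.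
Proof.
have /closed_rootP[y] : size ('X^l - (x + c)%:P : {poly F}) != 1%N.
  by rewrite size_XnsubC // eqSS -lt0n.
by rewrite /root !hornerE subr_eq0 => /eqP; exists y.
Qed.

Let p_dvd_q : (p %| q)%N.
Proof. by rewrite /q; apply: dvdn_exp. Qed.

(** As long as [w y < w c], the sum [y + c] has valuation [w y], and taking a preimage divides it by
    [l]. *)
Lemma wild_of_val_lt n x (s : rat) : level n x -> w x = s%:E -> s != 0 ->
  (s%:E < w c)%E -> wild_valuations.
Proof.
move=> nx Ex s0 sc; exists s, l; split=> //; first by rewrite dvdn_mulr.
move=> k; suff [i [y [iy Ey _]]] : exists i y, [/\ level i y, w y = (s / (l ^ k)%:R)%:E &
    ((s / (l ^ k)%:R)%:E < w c)%E] by exists i; exists y => //; apply: T_iter.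
elim: k => [|k [i [y [iy Ey yc]]]]; first by exists n, x; rewrite expn0 divr1.
have [z Ez] := preimage_exists y.
have Es : s / (l ^ k.+1)%:R = s / (l ^ k)%:R / l%:R :> rat.
  by rewrite expnSr natrM invfM mulrA.
exists i.+1, z; split; first exact: level_preimage Ez.
  rewrite Es; apply: (val_root w_val l_gt0).
  by rewrite Ez (valD_eql w_val) Ey.
rewrite Es; set b := s / _ in Ey yc *.
have l1 : 1 <= l%:R :> rat by rewrite ler1n.
have lp : 0 < l%:R :> rat by rewrite ltr0n.
(* Division by [l] does not increase a nonnegative value, and a negative one stays below
   [0 <= w c]. *)
have [b0|b0] := leP 0 b.
  by apply: le_lt_trans yc; rewrite lee_fin ler_pdivrMr // ler_peMr.
by apply: lt_le_trans c_int; rewrite lte_fin ltr_pdivrMr // mul0r.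
Qed.

(** If [z + c] is not a unit, take an [m]-th root of unity [u] with [1 - u] a unit: then
    [u z + c = (z + c) - (1 - u) z] is a unit. *)
Lemma unit_preimage y : w (y + c) = 0%:E -> exists z,
  [/\ z ^+ l = y + c, w z = 0%:E & m = 1%N \/ w (z + c) = 0%:E].
Proof.
move=> wyc; have [z Ez] := preimage_exists y.
have unit x : x ^+ l = y + c -> w x = 0%:E.
  move=> Ex; rewrite -[0](mul0r (l%:R^-1)).
  by apply: (val_root w_val l_gt0); rewrite Ex.
have [m1|m1] := eqVneq m 1%N; first by exists z; split; auto.
have m_gt1 : (1 < m)%N by rewrite ltn_neqAle eq_sym m1.
have [u um wu] := unity_root_val0 w_val p_prime wp m_gt1 pNm.
have [] := eqVneq (w (z + c)) 0%:E => wzc; first by exists z; split; auto.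
exists (u * z).
have Eu : (u * z) ^+ l = y + c by rewrite exprMn {1}/l mulnC exprM um expr1n mul1r.
split; auto; right.
have wzc0 : (0%:E < w (z + c))%E.
  rewrite lt_neqAle eq_sym wzc /=; apply: val_geD => //.
  by rewrite unit.
have wuz : w (- ((1 - u) * z)) = 0%:E.
  by rewrite (valN w_val) (valM w_val wu (unit z Ez)) addr0.
have -> : u * z + c = - ((1 - u) * z) + (z + c) by ring.
by rewrite (valD_eql w_val) wuz.
Qed.

(** Each use of [preimage_step] divides the distance by [q]. The point [z] stays integral and, for
    [m > 1], [z + c] stays a unit, so the next preimage can again be chosen a unit. *)
Lemma wild_of_close_pair n x y (d : rat) : level n y -> level n x ->
  w (y - x) = d%:E -> 0 < d <= 1 -> (0%:E <= w y)%E -> m = 1%N \/ w (y + c) = 0%:E ->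
  wild_valuations.
Proof.
move=> ny nx Ed d01 y0 mc; exists d, q; split=> //.
- by case/andP: d01 => /gt_eqF ->.
- exact: ltnW.
move=> k; suff [i [z [t [iz it Ezt [z0 mz]]]]] : exists i z t, [/\ level i z, level i t,
    w (z - t) = (d / (q ^ k)%:R)%:E & (0%:E <= w z)%E /\ (m = 1%N \/ w (z + c) = 0%:E)].
  by exists i; exists (z - t) => //; apply: T_sub; apply: T_iter.
elim: k => [|k [i [z [t [iz it Ezt [z0 mz]]]]]].
  by exists n, y, x; rewrite expn0 divr1.
have dk : 0 < d / (q ^ k)%:R <= 1.
  have q0 : 0 < (q ^ k)%:R :> rat by rewrite ltr0n expn_gt0 ltnW.
  case/andP: d01 => d0 d1; rewrite divr_gt0 //= ler_pdivrMr // mul1r.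
  by apply: le_trans d1 _; rewrite ler1n expn_gt0 ltnW.
have [z' [Ez' z'0 mz' mz'c]] : exists z', [/\ z' ^+ l = z + c, (0%:E <= w z')%E,
    m = 1%N \/ w z' = 0%:E & m = 1%N \/ w (z' + c) = 0%:E].
  case: mz => [m1|/unit_preimage[z' [Ez' wz' mz']]]; last first.
    by exists z'; split; rewrite ?wz' //; right.
  have [z' Ez'] := preimage_exists z; exists z'; split; auto.
  by apply: (val_root_ge0 w_val l_gt0); rewrite Ez'; apply: val_geD.
have [t' Et' Ezt'] := preimage_step w_val p_prime wp m_gt0 pNm Ez' z'0 mz' Ezt dk.
exists i.+1, z', t'; split; [exact: level_preimage Ez' | exact: level_preimage Et' | | by []].
by rewrite Ezt' expnSr natrM invfM mulrA.
Qed.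

Lemma wild_of_unit n x : level n x -> w (x + c) = 0%:E -> wild_valuations.
Proof.
move=> nx /unit_preimage[y [Ey wy mc]].
have [z [zq [b Eb [b0 rb]]]] := unity_root_p w_val p_prime wp r_gt0.
apply: (@wild_of_close_pair n.+1 (z * y) y b) => //; last by rewrite wy.
- exact: level_preimage Ey.
- by apply: level_preimage nx _; rewrite exprMn {1}/l exprM zq expr1n mul1r.
- have -> : y - z * y = (1 - z) * y by ring.
  by rewrite (valM w_val Eb wy) addr0.
(* [b <= 1] follows from [(q - 1) b <= r] and [r < p^r = q]. *)
rewrite b0 /=; have rq : (r <= q.-1)%N by rewrite -ltnS prednK ?(ltnW q_gt1) // ltn_expl ?prime_gt1.
have q1 : 0 < q.-1%:R :> rat by rewrite ltr0n -ltnS prednK // ltnW.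
rewrite -(ler_pM2l q1) mulr1; apply: le_trans rb _.
by rewrite ler_nat.
Qed.

(** If [w x > w c], then [x + c] has valuation [w c]: either it is a unit, or preimages of [x] have
    valuation [w c / l], strictly between 0 and [w c]. *)
Lemma wild_or_val_eq n x : level n x -> (0%:E < w x)%E ->
  wild_valuations \/ w x = w c.
Proof.
have [b Eb] := val_fin w_val c_neq0.
move=> nx x0; have [xc|cx|->] := ltgtP (w x) (w c); last by right.
  have xn0 : x != 0.
    by apply: contraTneq xc => ->; rewrite (val0 w_val) Eb.
  have [s Es] := val_fin w_val xn0; left; apply: (wild_of_val_lt nx Es); last by rewrite -Es.
  by rewrite Es lte_fin in x0; rewrite gt_eqF.
have [b0|b0] := eqVneq b 0.
  left; apply: (wild_of_unit nx); rewrite addrC (valD_eql w_val) // Eb b0 //.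
have bp : 0 < b.
  by have := c_int; rewrite Eb lee_fin lt_neqAle eq_sym b0.
have [y Ey] := preimage_exists x; left.
have wy : w y = (b / l%:R)%:E.
  by apply: (val_root w_val l_gt0); rewrite Ey addrC (valD_eql w_val) // Eb.
apply: (wild_of_val_lt (level_preimage nx Ey) wy).
  by rewrite mulf_neq0 // invr_eq0 pnatr_eq0 -lt0n.
by rewrite Eb lte_fin ltr_pdivrMr ?ltr0n // ltr_pMr // ltr1n.
Qed.

(* Otherwise y + c and z y + c have valuation l v(c) whenever z^l = 1 and y is a
   preimage of x, hence (l - 1) v(c) <= v(1 - z). *)
Lemma wild_of_val_gt0 n x : l <> p -> level n x -> (0%:E < w x)%E -> (0%:E < w c)%E ->
  wild_valuations.
Proof.
move=> lp nx x0 c0; apply: contrapT => nwild.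
have [b Eb] := val_fin w_val c_neq0; rewrite Eb lte_fin in c0.
have stuck i y : level i y -> (0%:E < w y)%E -> w y = b%:E.
  by move=> iy y0; case: (wild_or_val_eq iy y0) => // ->.
have preim0 y z : (0%:E < w y)%E -> z ^+ l = y + c -> (0%:E < w z)%E.
  move=> y0 Ez; apply: (val_root_gt0 w_val l_gt0); rewrite Ez.
  by apply: val_gtD; rewrite // Eb lte_fin.
(* A preimage [z] of [y] is stuck at valuation [b] as well, and [z^l = y + c]. *)
have wshift y : y ^+ l = x + c -> w y = b%:E /\ w (y + c) = (l%:R * b)%:E.
  move=> Ey; have ny := level_preimage nx Ey; have y0 := preim0 _ _ x0 Ey.
  split; first exact: stuck ny y0.
  have [z Ez] := preimage_exists y.
  have := stuck _ _ (level_preimage ny Ez) (preim0 _ _ y0 Ez).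
  by move=> /(valX w_val l); rewrite Ez.
have [y Ey] := preimage_exists x; have [wy wyc] := wshift y Ey.
have root_bound z (e : rat) : z ^+ l = 1 -> w (1 - z) = e%:E -> l%:R * b <= e + b.
  move=> zl Ee; have [|_ wzyc] := wshift (z * y); first by rewrite exprMn zl mul1r.
  rewrite -lee_fin -(valM w_val Ee wy).
  have -> : (1 - z) * y = (y + c) - (z * y + c) by ring.
  by apply: val_geD; rewrite ?(valN w_val) ?wyc ?wzyc.
have [m1|m1] := eqVneq m 1%N; last first.
  have m_gt1 : (1 < m)%N by rewrite ltn_neqAle eq_sym m1.
  (* Since [1 - u] is a unit, the bound becomes [l b <= b], impossible for [b > 0]. *)
  have [u um wu] := unity_root_val0 w_val p_prime wp m_gt1 pNm.
  have : l%:R * b <= 0 + b.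
    by apply: root_bound wu; rewrite /l mulnC exprM um expr1n.
  by rewrite add0r ger_pMl // lern1 leqNgt l_gt1.
have lq : l = q by rewrite /l m1 muln1.
have [z [zq [e Ee [e0 re]]]] := unity_root_p w_val p_prime wp r_gt0.
have := root_bound z e; rewrite lq => /(_ zq Ee) be.
apply: nwild; apply: (@wild_of_close_pair n.+1 (z * y) y (e + b)).
- exact: level_preimage Ey.
- by apply: level_preimage nx _; rewrite exprMn {1}lq zq mul1r.
- have -> : y - z * y = (1 - z) * y by ring.
  by rewrite (valM w_val Ee wy).
(* Here [q = l <> p] excludes [r = 1], and then [r + 2 <= q]. *)
- have r2 : (1 < r)%N.
    by rewrite ltn_neqAle r_gt0 andbT; apply/eqP => r1; apply: lp; rewrite lq /q -r1 expn1.
  have rq : (r + 2 <= q)%N.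
    have p1 := prime_gt1 p_prime; rewrite /q -(subnK r2) addn2.
    elim: (r - 2)%N => [|k IH]; first exact: (leq_mul p1 p1).
    by rewrite expnS; apply: leq_trans (leq_mul p1 IH); lia.
  have Eq : q%:R = q.-1%:R + 1 :> rat by rewrite natr1 prednK // ltnW.
  set Q : rat := q.-1%:R in Eq re.
  (* From [Q b <= e] and [Q e <= r] one gets [Q^2 (e + b) <= Q e (Q + 1) <= r (Q + 1) <= Q^2], hence
     [e + b <= 1]. *)
  have rQ : r%:R * (Q + 1) <= Q * Q :> rat.
    by rewrite -Eq /Q -!natrM ler_nat; case: (q) rq => // k; nia.
  have Q0 : 0 < Q by rewrite /Q ltr0n -ltnS prednK // ltnW.
  rewrite Eq in be; have Qe : Q * e * (Q + 1) <= r%:R * (Q + 1).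
    by rewrite ler_pM2r //; lra.
  have bQ : Q * (Q * b) <= Q * e by rewrite ler_pM2l //; lra.
  apply/andP; split; first lra.
  by rewrite -(ler_pM2l (mulr_gt0 Q0 Q0)); lra.
- by rewrite wy lee_fin ltW.
- by left.
Qed.

Lemma wild_backward_orbit : l <> p -> wild_valuations.
Proof.
move=> lp; have a_level : level 0 a by [].
have [a0|a0] := ltP (w a) 0%:E.
  have an0 : a != 0 by apply: contraTneq a0 => ->; rewrite (val0 w_val).
  have [s Es] := val_fin w_val an0; rewrite Es lte_fin in a0.
  apply: (wild_of_val_lt a_level Es); first by rewrite lt_eqF.
  by apply: lt_le_trans c_int; rewrite lte_fin.
have [wc|wc] := eqVneq (w c) 0%:E.
  have [ac|ac] := eqVneq (w (a + c)) 0%:E; first exact: wild_of_unit a_level ac.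
  (* As [a + c] is not a unit, [w y > 0], so [y + c] is a unit like [c]. *)
  have [y Ey] := preimage_exists a.
  apply: (wild_of_unit (level_preimage a_level Ey)).
  rewrite addrC (valD_eql w_val) // wc; apply: (val_root_gt0 w_val l_gt0).
  by rewrite Ey lt_neqAle eq_sym ac; apply: val_geD.
have c0 : (0%:E < w c)%E by rewrite lt_neqAle eq_sym wc.
have [wa|wa] := eqVneq (w a) 0%:E.
  by apply: (wild_of_unit a_level); rewrite (valD_eql w_val) wa.
by apply: (wild_of_val_gt0 lp a_level) => //; rewrite lt_neqAle eq_sym wa.
Qed.

End BackwardOrbit.

(** * From the backward orbit of [alpha] to the ramification of its preimage fields *)

Theorem theorem5p7
  (K : fieldType) (v : K -> \bar rat) (p : nat)
  (v_discrete : discrete_valuation v)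
  (v_complete : valuation_complete v)
  (v_residue : residue_char v p)
  (v_normalized : v p%:R = 1%:E)
  (Kbar : closedFieldType) (iota : {rmorphism K -> Kbar})
  (Kbar_closure : is_algebraic_closure iota)
  (* the (unique) extension of v to the algebraic closure *)
  (w : Kbar -> \bar rat) (w_valuation : is_valuation w)
  (w_extends : forall x : K, w (iota x) = v x)
  (l : nat) (l_ge2 : (2 <= l)%N) (p_dvd_l : (p %| l)%N) (l_neq_p : l <> p)
  (c : Kbar) (f_separable : separable_poly (unicritical l c))
  (alpha : K)
  (c_integral : (0 <= w c)%E) :
  infinitely_wildly_ramified iota w p
    (preimage_field iota (unicritical l c) alpha).
Proof.
have [p_prime _] := v_residue.
have [_ [g g0 v_g]] := v_discrete.
have wp : w p%:R = 1%:E by rewrite -(rmorph_nat iota) w_extends.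
have l0 : (0 < l)%N := ltnW l_ge2.
have [m pm El] := pfactor_coprime p_prime l0.
rewrite prime_coprime // in pm; set r := logn p l in El.
have r0 : (0 < r)%N by rewrite logn_gt0 mem_primes p_prime l0.
rewrite mulnC in El.
(* For [l >= 2] the polynomial [X^l] has the multiple root 0, against separability. *)
have c0 : c != 0.
  apply/eqP => c0; move: f_separable; rewrite /unicritical c0 subr0.
  have l1 : (l.-1 == 0)%N = false by case: (l) l_ge2 => [|[]].
  rewrite separable_poly.unlock => sep; have := coprimep_root sep (_ : root 'X^l 0).
  rewrite derivXn hornerMn /root !hornerXn !expr0n gtn_eqF // l1 mul0rn eqxx.
  by move/(_ isT).
pose T n := preimage_field iota (unicritical l c) alpha n.
have [d [N [d0 N0 pN dT]]] : wild_valuations w p T.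
  move: l_neq_p; rewrite El.
  apply: (wild_backward_orbit w_valuation p_prime wp r0 pm c0 c_integral (a := iota alpha)).
    by move=> n x nx; apply: adjoin_gen; rewrite El.
  move=> n x y Tx Ty; have [_ AB _] := @adjoin_closed _ _ iota
    [set beta | iter n (horner (unicritical l c)) beta = iota alpha].
  by have := AB x y; rewrite !inE; apply.
apply: (wildly_ramified_of_val g0 v_g w_valuation w_extends p_prime N0 pN d0 Kbar_closure) dT.
by move=> n; rewrite El; apply: preimage_seq.
Qed.
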